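(* Suppose the following statement (A) holds: for every $m\ge 1$ and all non-overlapping permutations $\pi,\tau\in\mathfrak{S}_m$ that are in standard form, if $\pi$ and $\tau$ are c-Wilf equivalent then $\pi_1=\tau_1$ and $\pi_m=\tau_m$. Then the following statement (B) holds: for every $m\ge 1$ and all permutations $\pi,\tau\in\mathfrak{S}_m$ in standard form, if $\pi$ and $\tau$ are strongly c-Wilf equivalent then $\pi_1=\tau_1$ and $\pi_m=\tau_m$.
   Context: $\mathfrak{S}_n$ is the symmetric group on $[n]$, permutations written $\sigma=\sigma_1\cdots\sigma_n$, and $\mathfrak{S}=\bigcup_{n\ge0}\mathfrak{S}_n$. The standardization $\operatorname{st}(w)$ of a word of distinct integers replaces its smallest entry by 1, the next smallest by 2, etc. For $\pi\in\mathfrak{S}_m$ and $\sigma\in\mathfrak{S}_n$, $\operatorname{Em}(\pi,\sigma)=\{i\in[n-m+1]:\operatorname{st}(\sigma_i\cdots\sigma_{i+m-1})=\pi\}$ and $\operatorname{em}(\pi,\sigma)=|\operatorname{Em}(\pi,\sigma)|$. Let $a^\pi_{n,k}$ be the number of $\sigma\in\mathfrak{S}_n$ with $\operatorname{em}(\pi,\sigma)=k$. Two permutations $\pi,\tau$ are c-Wilf equivalent if $a^\pi_{n,0}=a^\tau_{n,0}$ for all $n$, and strongly c-Wilf equivalent if $a^\pi_{n,k}=a^\tau_{n,k}$ for all $n,k$. The overlap set of $\pi\in\mathfrak{S}_m$ is $\mathcal{O}_\pi=\{i\in[m-1]:\operatorname{st}(\pi_{i+1}\cdots\pi_m)=\operatorname{st}(\pi_1\cdots\pi_{m-i})\}$;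 $\pi$ is non-overlapping if $\mathcal{O}_\pi=\{m-1\}$. A permutation $\pi\in\mathfrak{S}_m$ is in standard form if $\pi_1<\pi_m$ and $\pi_1+\pi_m\le m+1$. *)

(* Defs.v *)
From mathcomp Require Import all_boot all_order all_fingroup.
Set Implicit Arguments. Unset Strict Implicit. Unset Printing Implicit Defensive.

(* The one-line notation sigma_1 ... sigma_n of sigma in S_n, with values in
   {1,...,n} (the perm acts on 'I_n = {0,...,n-1}, so we add 1). *)
Definition pword n (s : 'S_n) : seq nat := [seq (s i).+1 | i <- enum 'I_n].

Definition st (w : seq nat) : seq nat := [seq (count (fun y => y < x) w).+1 | x <- w].

(* Em(p, w) with 0-based starting positions: i in {0,...,n-m} such that
   st(w_i ... w_{i+m-1}) = p, where m = size p, n = size w. *)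
Definition Em (p w : seq nat) : seq nat :=
  [seq i <- iota 0 ((size w).+1 - size p) | st (take (size p) (drop i w)) == p].

Definition em (p w : seq nat) : nat := size (Em p w).

Definition acount m (pi : 'S_m) (n k : nat) : nat :=
  #|[set s : 'S_n | em (pword pi) (pword s) == k]|.

Definition cwilf_equiv m (pi tau : 'S_m) : Prop :=
  forall n, acount pi n 0 = acount tau n 0.

Definition strong_cwilf_equiv m (pi tau : 'S_m) : Prop :=
  forall n k, acount pi n k = acount tau n k.

Definition overlap_set m (pi : 'S_m) : seq nat :=
  [seq i <- iota 1 m.-1 | st (drop i (pword pi)) == st (take (m - i) (pword pi))].

Definition non_overlapping m (pi : 'S_m) : Prop := overlap_set pi = [:: m.-1].

Definition pfirst m (pi : 'S_m) : nat := nth 0 (pword pi) 0.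
Definition plast m (pi : 'S_m) : nat := nth 0 (pword pi) m.-1.

Definition standard_form m (pi : 'S_m) : Prop :=
  pfirst pi < plast pi /\ pfirst pi + plast pi <= m.+1.

(* Main.v *)
(** The generating function of the occurrence statistic and the generating
    function of clusters (marked occurrences covering a word, consecutive ones
    sharing a letter) determine each other, as in the Goulden-Jackson method.
    The clusters with k occurrences and maximal length k(m-1)+1 are the chains,
    in which consecutive occurrences share one letter only; so strong
    equivalence preserves their numbers M_k. Permuting the inner positions of
    each block shows that M_k depends only on the pair (pi_1, pi_m). A
    non-overlapping permutation has no other clusters, so its numbers of
    avoiders are determined by the M_k. Hence the result follows from (A) once
    pi and tau are replaced by non-overlapping permutations with the same ends.
    These exist unless the ends are (1, m), or (2, 3) with m = 4. The exceptional
    ends (a, b) are recognized by the number of pairs of occurrences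
    M_2 = C(a+b-2, b-1) C(2m-a-b, m-b). *)

Require Import Defs.
From mathcomp Require Import all_boot all_order all_fingroup all_algebra zify.
Set Implicit Arguments. Unset Strict Implicit. Unset Printing Implicit Defensive.
Import GRing.Theory.
Implicit Types p q u v w : seq nat.

(** * Standardization *)

Definition rank w x : nat := count (fun y => y < x) w.

Lemma ltn_rank w x y : x \in w -> (rank w x < rank w y) = (x < y).
Proof.
move=> xw; case: (ltnP x y) => [lt_xy|le_yx]; last first.
  by apply/negbTE; rewrite -leqNgt sub_count // => z /= /leq_trans; apply.
have -> : rank w y = rank w x + count (fun z => x <= z < y) w.
  by rewrite /rank; elim: w {xw} => //= z w ->; case: (ltnP z x); lia.
by rewrite -addn1 leq_add2l -has_count; apply/hasP; exists x => //; rewrite leqnn.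
Qed.

Lemma rank_inj w : {in w &, injective (rank w)}.
Proof. by move=> x y xw yw eq_xy; have := ltn_rank y xw; have := ltn_rank x yw; lia. Qed.

Lemma stE w : st w = [seq (rank w x).+1 | x <- w].
Proof. by []. Qed.

Lemma size_st w : size (st w) = size w.
Proof. exact: size_map. Qed.

Lemma nth_st w i : i < size w -> nth 0 (st w) i = (rank w (nth 0 w i)).+1.
Proof. by move=> lt_iw; rewrite (nth_map 0). Qed.

Lemma ltn_nth_st w i j : i < size w -> j < size w ->
  (nth 0 (st w) i < nth 0 (st w) j) = (nth 0 w i < nth 0 w j).
Proof. by move=> ? ?; rewrite !nth_st // ltnS ltn_rank ?mem_nth. Qed.

Lemma rank_map f w x : {in w, forall y, (f y < f x) = (y < x)} -> rank (map f w) (f x) = rank w x.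
Proof. by move=> f_mono; rewrite /rank count_map; apply: eq_in_count => y /f_mono. Qed.

Lemma st_map f w : {in w &, {mono f : x y / x < y}} -> st (map f w) = st w.
Proof.
move=> f_mono; rewrite !stE -map_comp; apply/eq_in_map => x xw /=.
by rewrite rank_map // => y yw; rewrite f_mono.
Qed.

Lemma st_map_rank u w : {subset u <= w} -> st [seq (rank w x).+1 | x <- u] = st u.
Proof. by move=> sub_uw; apply: st_map => x y /sub_uw xw _; rewrite ltnS ltn_rank. Qed.

Lemma st_take k w : st (take k (st w)) = st (take k w).
Proof. by rewrite [st w]stE -map_take st_map_rank // => x /mem_take. Qed.

Lemma st_drop k w : st (drop k (st w)) = st (drop k w).
Proof. by rewrite [st w]stE -map_drop st_map_rank // => x /mem_drop. Qed.

Lemma st_behead w : st (behead (st w)) = st (behead w).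
Proof. by rewrite -!drop1 st_drop. Qed.

Lemma st_inj_perm u v : perm_eq u v -> st u = st v -> u = v.
Proof.
move=> perm_uv eq_st; have eq_size := perm_size perm_uv.
have rank_uv x : rank u x = rank v x by rewrite /rank (seq.permP perm_uv).
apply: (@eq_from_nth _ 0) => // i lt_iu; have lt_iv := lt_iu; rewrite eq_size in lt_iv.
apply: (@rank_inj u); rewrite ?mem_nth //; first by rewrite (perm_mem perm_uv) mem_nth.
by apply: succn_inj; rewrite [in RHS]rank_uv -!nth_st ?eq_st.
Qed.

Lemma st_cons x w : x \notin w ->
  st (x :: w) = (rank w x).+1 :: [seq r + (rank w x < r) | r <- st w].
Proof.
move=> xw; rewrite !stE /= {1}/rank /= ltnn add0n; congr (_ :: _); rewrite -map_comp.
apply/eq_in_map => y yw /=.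
have neq_xy : x != y by apply: contraNneq xw => ->.
suff -> : (rank w x < (rank w y).+1) = (x < y) by rewrite /rank /= addSn addnC.
by rewrite ltnS leqNgt ltn_rank // -leqNgt ltn_neqAle neq_xy.
Qed.

Lemma st_cons_eq x y u v : x \notin u -> y \notin v ->
  (st (x :: u) == st (y :: v)) = (rank u x == rank v y) && (st u == st v).
Proof.
move=> xu yv; apply/eqP/andP => [eq_st|[/eqP eq_rank /eqP eq_st]]; last first.
  by rewrite !st_cons // eq_rank eq_st.
split; last by rewrite -[st u]/(st (behead (x :: u))) -st_behead eq_st st_behead.
by move: eq_st; rewrite !st_cons // => -[->].
Qed.

(** * Permutations as words *)

Lemma uniq_perm_size (T : eqType) (s t : seq T) :
  uniq s -> uniq t -> {subset s <= t} -> size t <= size s -> perm_eq s t.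
Proof. by move=> us ut sub le_ts; have [_ ?] := uniq_min_size us sub le_ts; apply: uniq_perm. Qed.

Definition words n : seq (seq nat) := permutations (iota 1 n).

Section WordsTheory.

Variables (n : nat) (w : seq nat).
Hypothesis w_words : w \in words n.

Lemma perm_words : perm_eq w (iota 1 n).
Proof. by rewrite -mem_permutations. Qed.

Lemma size_words : size w = n.
Proof. by rewrite (perm_size perm_words) size_iota. Qed.

Lemma uniq_words : uniq w.
Proof. by rewrite (perm_uniq perm_words) iota_uniq. Qed.

Lemma mem_words x : (x \in w) = (0 < x <= n).
Proof. by rewrite (perm_mem perm_words) mem_iota add1n ltnS. Qed.

Lemma nth_words i : i < n -> 0 < nth 0 w i <= n.
Proof. by move=> lt_in; rewrite -mem_words mem_nth ?size_words. Qed.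

Lemma rank_words x : 0 < x <= n -> rank w x = x.-1.
Proof.
case: x => // x le_xn; rewrite /rank (seq.permP perm_words) -size_filter -add1n.
by rewrite filter_iota_ltn ?size_iota // ltnW.
Qed.

Lemma st_words : st w = w.
Proof.
rewrite stE -[RHS]map_id; apply/eq_in_map => x; rewrite mem_words => x_n.
by rewrite rank_words //; lia.
Qed.

End WordsTheory.

Lemma in_words n w :
  uniq w -> size w = n -> (forall x, x \in w -> 0 < x <= n) -> w \in words n.
Proof.
move=> uw sw win; rewrite mem_permutations uniq_perm_size ?iota_uniq ?size_iota ?sw //.
by move=> x /win; rewrite mem_iota; lia.
Qed.

Lemma st_in_words w : uniq w -> st w \in words (size w).
Proof.
move=> uw; apply: in_words; rewrite ?size_st //.
  by rewrite map_inj_in_uniq // => x y xw yw [] /(rank_inj xw yw).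
move=> _ /mapP[x xw ->] /=; rewrite -(count_predC (fun y => y < x) w) -addn1 leq_add2l.
by rewrite -has_count; apply/hasP; exists x => //=; rewrite ltnn.
Qed.

Lemma size_permutation_words n : size (words n) = n`!.
Proof. by rewrite size_permutations ?iota_uniq // size_iota. Qed.

Lemma perm_map_words n (f : seq nat -> seq nat) :
  {in words n &, injective f} -> {in words n, forall w, f w \in words n} ->
  perm_eq [seq f w | w <- words n] (words n).
Proof.
move=> f_inj f_words; rewrite uniq_perm_size ?map_inj_in_uniq ?permutations_uniq ?size_map //.
by move=> _ /mapP[w /f_words ? ->].
Qed.

Lemma pword_words n (s : 'S_n) : pword s \in words n.
Proof.
apply: in_words.
- by rewrite map_inj_uniq ?enum_uniq // => i j [] /val_inj /perm_inj.
- by rewrite size_map size_enum_ord.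
by move=> x /mapP[i _ ->]; have := ltn_ord (s i); lia.
Qed.

Lemma size_pword n (s : 'S_n) : size (pword s) = n.
Proof. exact: size_words (pword_words s). Qed.

Lemma pword_inj n : injective (@pword n).
Proof.
move=> s t /eq_in_map eq_st; apply/permP => i.
by have [] := eq_st i (mem_enum _ _); move/val_inj.
Qed.

Lemma perm_pword n : perm_eq [seq pword s | s <- enum 'S_n] (words n).
Proof.
apply: uniq_perm_size; rewrite ?permutations_uniq //.
- by rewrite map_inj_uniq ?enum_uniq //; apply: pword_inj.
- by move=> _ /mapP[s _ ->]; apply: pword_words.
by rewrite size_permutation_words size_map -cardE card_Sn.
Qed.

Lemma pword_onto n w : w \in words n -> exists s : 'S_n, pword s = w.
Proof. by rewrite -(perm_mem (perm_pword n)) => /mapP[s _ ->]; exists s. Qed.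

Lemma acount_words m (pi : 'S_m) n k :
  acount pi n k = count (fun w => em (pword pi) w == k) (words n).
Proof.
rewrite /acount -(seq.permP (perm_pword n)) count_map -sum1_count -sum1_card.
by rewrite big_enum_cond; apply: eq_bigl => s; rewrite inE.
Qed.

(** * Cutting a permutation in two *)

Definition value_set n u : {set 'I_n} := [set i : 'I_n | i.+1 \in u].

Lemma card_value_set n u (a : pred nat) : uniq u -> (forall x, x \in u -> 0 < x <= n) ->
  #|[set i in value_set n u | a i.+1]| = count a u.
Proof.
move=> uu un; rewrite cardE -(size_map (fun i : 'I_n => i.+1)) -size_filter.
apply/perm_size/uniq_perm; rewrite ?filter_uniq //.
  by rewrite map_inj_uniq ?enum_uniq // => i j [] /val_inj.
move=> x; rewrite mem_filter; apply/mapP/andP => [[i]|[ax xu]].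
  by rewrite mem_enum !inE => /andP[? ?] ->.
case: x ax xu (un x xu) => // x ax xu lt_xn.
by exists (Ordinal lt_xn); rewrite // mem_enum !inE ax andbT.
Qed.

Definition cut_word n l w := (value_set n (take l w), (st (take l w), st (drop l w))).

Lemma cut_word_inj n l : {in words n &, injective (cut_word n l)}.
Proof.
move=> w w' wn wn' [/setP eq_set eq_take eq_drop].
have perm_take : perm_eq (take l w) (take l w').
  apply: uniq_perm; rewrite ?take_uniq ?(uniq_words wn) ?(uniq_words wn') // => -[|x].
    by apply/idP/idP => /mem_take; rewrite ?(mem_words wn) ?(mem_words wn').
  case: (ltnP x n) => [lt_xn|le_nx]; first by have := eq_set (Ordinal lt_xn); rewrite !inE.
  by apply/idP/idP => /mem_take; rewrite ?(mem_words wn) ?(mem_words wn'); lia.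
have perm_drop : perm_eq (drop l w) (drop l w').
  rewrite -(perm_cat2l (take l w)) cat_take_drop (perm_trans (perm_words wn)) //.
  rewrite perm_sym (perm_trans _ (perm_words wn')) //.
  by rewrite -[X in perm_eq _ X](cat_take_drop l w') perm_cat2r.
rewrite -[LHS](cat_take_drop l) (st_inj_perm perm_take eq_take) (st_inj_perm perm_drop eq_drop).
exact: cat_take_drop.
Qed.

(* Injectivity of [cut_word] and the identity [n! = 'C(n, l) * l! * (n - l)!]
   give the bijection. *)
Lemma perm_cut_words n l : l <= n ->
  perm_eq [seq cut_word n l w | w <- words n]
    [seq (A, uv) | A <- enum [set A : {set 'I_n} | #|A| == l],
                   uv <- [seq (u, v) | u <- words l, v <- words (n - l)]].
Proof.
move=> le_ln; apply: uniq_perm_size.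
- by rewrite map_inj_in_uniq ?permutations_uniq //; apply: cut_word_inj.
- apply: allpairs_uniq; rewrite ?enum_uniq //; last by move=> [? ?] [? ?].
  by apply: allpairs_uniq; rewrite ?permutations_uniq // => -[? ?] [? ?].
- move=> _ /mapP[w wn ->]; have uw := uniq_words wn.
  have size_take_w : size (take l w) = l by rewrite size_takel ?(size_words wn).
  have size_drop_w : size (drop l w) = n - l by rewrite size_drop (size_words wn).
  have take_n x : x \in take l w -> 0 < x <= n by move/mem_take; rewrite (mem_words wn).
  apply/allpairs_f/allpairs_f; last 2 first.
  + by rewrite -[X in words X]size_take_w st_in_words ?take_uniq.
  + by rewrite -[X in words X]size_drop_w st_in_words ?drop_uniq.
  rewrite mem_enum inE -[X in _ == X]size_take_w -count_predT.
  rewrite -(card_value_set predT _ take_n) ?take_uniq //.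
  by apply/eqP/eq_card => i; rewrite !inE andbT.
by rewrite !size_allpairs size_map !size_permutation_words -cardE card_draws card_ord bin_fact.
Qed.

Lemma big_words_cut (R : Type) (idx : R) (op : Monoid.com_law idx) n l
    (F : {set 'I_n} -> seq nat -> seq nat -> R) : l <= n ->
  \big[op/idx]_(w <- words n) F (value_set n (take l w)) (st (take l w)) (st (drop l w)) =
  \big[op/idx]_(A : {set 'I_n} | #|A| == l)
    \big[op/idx]_(u <- words l) \big[op/idx]_(v <- words (n - l)) F A u v.
Proof.
move=> le_ln; transitivity (\big[op/idx]_(x <- [seq cut_word n l w | w <- words n])
  F x.1 x.2.1 x.2.2); first by rewrite big_map.
rewrite (perm_big _ (perm_cut_words le_ln)) big_allpairs big_enum /=.
by apply: eq_big => [A|A _]; rewrite ?inE // big_allpairs.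
Qed.

Local Open Scope ring_scope.

Lemma sum_words_cut (R : comPzRingType) n l (f g : seq nat -> R) : (l <= n)%N ->
  \sum_(w <- words n) f (st (take l w)) * g (st (drop l w)) =
  'C(n, l)%:R * ((\sum_(u <- words l) f u) * (\sum_(v <- words (n - l)) g v)).
Proof.
move=> le_ln; rewrite (big_words_cut _ (fun _ u v => f u * g v)) // sumr_const.
rewrite -cardsE card_draws card_ord mulr_natl; congr (_ *+ _).
by rewrite big_distrl; apply: eq_bigr => u _; rewrite big_distrr.
Qed.

(** * Occurrences and clusters *)

Definition occ p w : bool := st (take (size p) w) == p.

Lemma occ_size p w : occ p w -> (size p <= size w)%N.
Proof. by move/eqP/(congr1 size); rewrite size_st size_take_min => <-; rewrite geq_minr. Qed.

Lemma occ_take p l w : (size p <= l)%N -> occ p (take l w) = occ p w.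
Proof. by move=> le_pl; rewrite /occ take_takel. Qed.

Lemma occ_st p w : occ p (st w) = occ p w.
Proof. by rewrite /occ st_take. Qed.

Lemma em_st p w : em p (st w) = em p w.
Proof.
rewrite /em /Em size_st; congr size; apply: eq_filter => i.
by rewrite -st_take st_drop st_take.
Qed.

Section Clusters.

Variable p : seq nat.
Hypothesis p_neq0 : p != [::].

Lemma occ_nil : occ p [::] = false.
Proof. by case: p p_neq0. Qed.

Lemma em_nil : em p [::] = 0%N.
Proof. by case: p p_neq0. Qed.

Lemma em_cons x w : em p (x :: w) = (occ p (x :: w) + em p w)%N.
Proof.
rewrite /em /Em !size_filter /=.
case: (leqP (size p) (size w).+1) => [le_pw|lt_wp]; last first.
  have [-> ->] : ((size w).+2 - size p = 0 /\ (size w).+1 - size p = 0)%N by lia.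
  by case: (boolP (occ p _)) => // /occ_size; rewrite leqNgt lt_wp.
by rewrite subSn //= -[1%N]/(1 + 0)%N iotaDl count_map.
Qed.

Definition em_weight w : {poly int} := (1 + 'X) ^+ em p w.

Lemma em_weightB_behead w :
  em_weight w - em_weight (behead w) = (occ p w)%:R * 'X * em_weight (behead w).
Proof.
case: w => [|x w] /=; first by rewrite occ_nil !mul0r subrr.
rewrite /em_weight em_cons; case: (occ p _); last by rewrite !mul0r subrr.
by rewrite add1n exprS mulrDl !mul1r addrC addKr.
Qed.

(* The polynomial enumerating, by number of marked occurrences, the ways of
   marking occurrences of [p] in [w] so that the first one starts at the
   beginning of [w], the last one ends at its end, and consecutive ones share
   a letter; [d.+1] is the distance between the first two marked occurrences. *)
Fixpoint cluster w : {poly int} :=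
  if w is _ :: w' then
    (occ p w)%:R * 'X *
      ((size w == size p)%:R + \sum_(0 <= d < (size p).-1) cluster (drop d w'))
  else 0.

Lemma clusterE w :
  cluster w = (occ p w)%:R * 'X *
    ((size w == size p)%:R + \sum_(1 <= d < size p) cluster (drop d w)).
Proof.
case: w => [|x w]; first by rewrite occ_nil !mul0r.
by rewrite (big_addn 0 _ 1) subn1 /=; under [in RHS]eq_bigr do rewrite addn1.
Qed.

Lemma cluster_nocc w : ~~ occ p w -> cluster w = 0.
Proof. by move=> /negbTE occF; rewrite clusterE occF !mul0r. Qed.

Lemma cluster_small w : (size w < size p)%N -> cluster w = 0.
Proof.
by move=> lt_wp; rewrite cluster_nocc //; apply: contraL lt_wp => /occ_size; rewrite -leqNgt.
Qed.

Lemma cluster_st w : cluster (st w) = cluster w.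
Proof.
have [k] := ubnP (size w); elim: k w => // k IH w lt_wk.
rewrite !clusterE size_st occ_st; case: (boolP (occ p w)) => [occw|_]; last by rewrite !mul0r.
have := occ_size occw; have : (0 < size p)%N by rewrite lt0n size_eq0.
move=> p_gt0 le_pw; congr (_ * (_ + _)); apply: eq_big_nat => d /andP[d_gt0 _].
by rewrite -IH ?size_drop ?size_st ?st_drop ?IH // ?size_drop; lia.
Qed.

Definition cluster_conv w : {poly int} :=
  \sum_(0 <= l < (size w).+1) cluster (take l w) * em_weight (drop l w).

Lemma cluster_conv_drop d w : (d <= size w)%N ->
  cluster_conv (drop d w) =
  \sum_(0 <= l < (size w).+1) cluster (take (l - d) (drop d w)) * em_weight (drop l w).
Proof.
move=> le_dw; rewrite [RHS](big_cat_nat (n := d)) ?leqW //=.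
rewrite [X in X + _]big1_seq ?add0r => [|l].
  rewrite -[X in \sum_(X <= _ < _) _]add0n big_addn subSn // -size_drop.
  by apply: eq_bigr => l _; rewrite addnK drop_drop.
rewrite mem_index_iota => /andP[_ lt_ld].
have /eqP-> : (l - d == 0)%N by rewrite subn_eq0 ltnW.
by rewrite take0 mul0r.
Qed.

Lemma cluster_take l w : occ p w -> (l <= size w)%N ->
  cluster (take l w) =
  'X * ((l == size p)%:R + \sum_(1 <= d < size p) cluster (take (l - d) (drop d w))).
Proof.
move=> occw le_lw; case: (leqP (size p) l) => [le_pl|lt_lp].
  rewrite clusterE occ_take // occw mul1r size_takel //; congr (_ * (_ + _)).
  by apply: eq_big_nat => d /andP[_ lt_dp]; rewrite take_drop subnK // ltnW // (leq_trans lt_dp).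
rewrite cluster_small ?size_takel // (ltn_eqF lt_lp) add0r big1_seq ?mulr0 // => d.
by rewrite mem_index_iota => d_p; rewrite cluster_small // size_take_min; lia.
Qed.

Lemma cluster_conv_occ w : occ p w ->
  cluster_conv w = 'X * (em_weight (drop (size p) w) +
                         \sum_(1 <= d < size p) cluster_conv (drop d w)).
Proof.
move=> occw; have le_pw := occ_size occw.
transitivity (\sum_(0 <= l < (size w).+1) 'X * ((l == size p)%:R * em_weight (drop l w) +
    \sum_(1 <= d < size p) cluster (take (l - d) (drop d w)) * em_weight (drop l w))).
  by apply: eq_big_nat => l /andP[_ le_lw]; rewrite cluster_take // -mulrA mulrDl big_distrl.
rewrite -big_distrr big_split exchange_big /=; congr (_ * (_ + _)); last first.
  by apply: eq_big_nat => d /andP[_ lt_dp]; rewrite cluster_conv_drop // (leq_trans (ltnW lt_dp)).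
rewrite (bigD1_seq (size p)) ?iota_uniq ?mem_index_iota //= eqxx mul1r.
by rewrite big1 ?addr0 // => l /negbTE->; rewrite mul0r.
Qed.

Lemma cluster_conv_nocc w : ~~ occ p w -> cluster_conv w = 0.
Proof.
move=> noccw; apply: big1 => l _; case: (leqP (size p) l) => [le_pl|lt_lp].
  by rewrite cluster_nocc ?mul0r // occ_take.
by rewrite cluster_small ?mul0r // size_take_min gtn_min lt_lp.
Qed.

Lemma em_weight_cluster w : em_weight w = em_weight (behead w) + cluster_conv w.
Proof.
have [k] := ubnP (size w); elim: k w => // k IH w lt_wk.
apply/eqP; rewrite addrC -subr_eq em_weightB_behead; apply/eqP.
case: (boolP (occ p w)) => [occw|noccw]; last by rewrite cluster_conv_nocc // !mul0r.
rewrite mul1r cluster_conv_occ //; congr ('X * _).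
have p_gt0 : (0 < size p)%N by rewrite lt0n size_eq0.
have conv_drop d : (1 <= d < size p)%N ->
    cluster_conv (drop d w) = em_weight (drop d w) - em_weight (drop d.+1 w).
  move=> /andP[d_gt0 lt_dp]; have le_pw := occ_size occw.
  rewrite (IH (drop d w)) ?size_drop; last by lia.
  by rewrite -[behead _]drop1 drop_drop add1n addrAC subrr add0r.
rewrite (eq_big_nat _ _ conv_drop) -[\sum_(_ <= _ < _) _]opprK -sumrN.
under eq_bigr do rewrite opprB.
by rewrite (telescope_sumr (fun d => em_weight (drop d w))) // drop1 opprB addrC subrK.
Qed.

Definition em_sum n : {poly int} := \sum_(w <- words n) em_weight w.
Definition cluster_sum n : {poly int} := \sum_(w <- words n) cluster w.

Lemma em_sum0 : em_sum 0 = 1.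
Proof. by rewrite /em_sum big_seq1 /em_weight em_nil. Qed.

Lemma cluster_sum0 : cluster_sum 0 = 0.
Proof. by rewrite /cluster_sum big_seq1. Qed.

(* For the exponential generating functions E(z) of [em_sum] and C(z) of
   [cluster_sum], this says E = 1 + z E + C E. *)
Lemma em_sumS n :
  em_sum n.+1 = n.+1%:R * em_sum n +
    \sum_(0 <= l < n.+2) 'C(n.+1, l)%:R * (cluster_sum l * em_sum (n.+1 - l)).
Proof.
transitivity (\sum_(w <- words n.+1) (1 * em_weight (st (drop 1 w)) +
   \sum_(0 <= l < n.+2) cluster (st (take l w)) * em_weight (st (drop l w)))).
  apply: eq_big_seq => w wn; rewrite em_weight_cluster mul1r drop1 /em_weight em_st.
  rewrite /cluster_conv (size_words wn); congr (_ + _).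
  by apply: eq_bigr => l _; rewrite cluster_st em_st.
rewrite big_split /= (sum_words_cut (fun=> 1)) // bin1 subn1 big_seq1 mul1r.
congr (_ + _); rewrite exchange_big /=; apply: eq_big_nat => l /andP[_ lt_ln].
by rewrite sum_words_cut.
Qed.

Lemma hornerN1_em_sum n : (em_sum n).[-1] = (count (fun w => em p w == 0%N) (words n))%:R.
Proof.
rewrite horner_sum -sum1_count natr_sum [RHS]big_mkcond; apply: eq_bigr => w _.
by rewrite horner_exp hornerD hornerC hornerX subrr expr0n; case: eqP.
Qed.

End Clusters.

Lemma em_sum_cluster_sum p q : p != [::] -> q != [::] ->
  em_sum p =1 em_sum q <-> cluster_sum p =1 cluster_sum q.
Proof.
move=> p_neq0 q_neq0; split=> eq_pq n; elim/ltn_ind: n => -[|n] IH.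
- by rewrite !cluster_sum0.
- have := eq_pq n.+1; rewrite !em_sumS // eq_pq => /addrI.
  rewrite !(big_nat_recr n.+1) //= subnn binn !mul1r !em_sum0 // !mulr1.
  rewrite (eq_big_nat _ _ (F2 := fun l =>
    'C(n.+1, l)%:R * (cluster_sum q l * em_sum q (n.+1 - l)))).
    by move/addrI.
  by move=> l /andP[_ lt_ln]; rewrite IH // eq_pq.
- by rewrite !em_sum0.
rewrite !em_sumS // IH //; congr (_ + _); apply: eq_big_nat => -[|l] _.
  by rewrite !cluster_sum0 // !mul0r.
by rewrite eq_pq IH //; lia.
Qed.

(** * Chains of occurrences sharing one letter *)

Fixpoint chain p k w : bool :=
  if k is k'.+1 then occ p w && chain p k' (drop (size p).-1 w) else size w == 1%N.

Definition chain_count p k : nat := count (chain p k) (words (k * (size p).-1).+1).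

Definition overlap_free p : bool :=
  all (fun d => st (drop d p) != st (take (size p - d) p)) (iota 1 (size p).-2).

Lemma overlap_free_occ p w d : overlap_free p -> occ p w -> (0 < d < (size p).-1)%N ->
  ~~ occ p (drop d w).
Proof.
move=> /allP p_free /eqP occ_w d_p; apply: contraNN (p_free d _); last by rewrite mem_iota; lia.
move=> /eqP occ_dw; rewrite -{1}occ_w -{3}occ_dw st_drop st_take take_takel ?leq_subr //.
by rewrite take_drop subnK //; lia.
Qed.

Section Chains.

Variable p : seq nat.
Hypothesis p_gt1 : (1 < size p)%N.

Let p_neq0 : p != [::]. Proof. by case: p p_gt1. Qed.

Lemma chain_size k w : chain p k w -> size w = (k * (size p).-1).+1.
Proof.
elim: k w => [|k IH] w /=; first by move/eqP.
by case/andP=> /occ_size le_pw /IH; rewrite size_drop mulSn; lia.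
Qed.

Lemma coef_clusterS k w :
  (cluster p w)`_k.+1 =
  (occ p w)%:R * (((size w == size p) && (k == 0%N))%:R
                  + \sum_(1 <= d < size p) (cluster p (drop d w))`_k).
Proof.
rewrite clusterE //; case: (occ p w); rewrite ?mul0r ?coef0 // !mul1r coefXM /=.
by rewrite coefD coef_sum -polyC_natr coefC; case: k => [|k] /=; rewrite ?andbT ?andbF.
Qed.

Lemma coef0_cluster w : (cluster p w)`_0 = 0.
Proof. by rewrite clusterE // -mulrA mulrCA coefXM. Qed.

Lemma coef_cluster_gt k w : ((k * (size p).-1).+1 < size w)%N -> (cluster p w)`_k = 0.
Proof.
elim: k w => [|k IH] w; first by rewrite coef0_cluster.
rewrite mulSn => lt_kw; rewrite coef_clusterS big1_seq => [|d].
  case: k {IH} lt_kw => [|k] lt_kw; last by rewrite andbF addr0 mulr0.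
  by rewrite (_ : size w == size p = false) ?addr0 ?mulr0 //; lia.
by rewrite mem_index_iota => d_p; rewrite IH // size_drop; lia.
Qed.

Lemma coef_cluster_chainS k w :
  (forall d, occ p w -> (0 < d < (size p).-1)%N -> (cluster p (drop d w))`_k = 0) ->
  (cluster p (drop (size p).-1 w))`_k = ((0 < k)%N && chain p k (drop (size p).-1 w))%:R ->
  (cluster p w)`_k.+1 = (chain p k.+1 w)%:R.
Proof.
move=> cluster_drop0 cluster_drop; rewrite coef_clusterS /=.
case: (boolP (occ p w)) => [occw|_]; last by rewrite mul0r.
have le_pw := occ_size occw; have def_p : size p = (size p).-1.+1 by lia.
rewrite mul1r def_p big_nat_recr /=; last by lia.
rewrite big1_seq ?add0r => [|d]; last first.
  by rewrite mem_index_iota => /andP[_]; exact: cluster_drop0.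
rewrite cluster_drop; case: k {cluster_drop0 cluster_drop} => [|k]; last by rewrite andbF add0r.
by rewrite andbT addr0 /= size_drop; congr (_%:R); lia.
Qed.

Lemma coef_cluster_long k w : (k * (size p).-1 < size w)%N ->
  (cluster p w)`_k = ((0 < k)%N && chain p k w)%:R.
Proof.
elim: k w => [|k IH] w; first by rewrite coef0_cluster.
rewrite mulSn => lt_kw; apply: coef_cluster_chainS => [d _ d_p|].
  by rewrite coef_cluster_gt // size_drop; lia.
by rewrite IH // size_drop; lia.
Qed.

Lemma coef_cluster_overlap_free k w : overlap_free p ->
  (cluster p w)`_k = ((0 < k)%N && chain p k w)%:R.
Proof.
move=> p_free; elim: k w => [|k IH] w; first by rewrite coef0_cluster.
apply: coef_cluster_chainS => // d occw d_p.
by rewrite cluster_nocc ?coef0 // overlap_free_occ.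
Qed.

Lemma coef_cluster_sum_chain_count k : (0 < k)%N ->
  (cluster_sum p (k * (size p).-1).+1)`_k = (chain_count p k)%:R.
Proof.
move=> k_gt0; rewrite coef_sum /chain_count -sum1_count natr_sum [RHS]big_mkcond.
apply: eq_big_seq => w wn; rewrite coef_cluster_long ?(size_words wn) // k_gt0.
by case: chain.
Qed.

Lemma coef_cluster_sum_overlap_free k n : overlap_free p ->
  (cluster_sum p n)`_k =
  (if (0 < k)%N && (n == (k * (size p).-1).+1) then chain_count p k else 0)%:R.
Proof.
move=> p_free; case: (posnP k) => [->|k_gt0] /=.
  by rewrite coef_sum big1 // => w _; rewrite coef_cluster_overlap_free.
case: eqP => [->|neq_n]; first exact: coef_cluster_sum_chain_count.
rewrite coef_sum big1_seq // => w /andP[_ wn]; rewrite coef_cluster_overlap_free //.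
by case: (boolP (chain p k w)) => [/chain_size|]; rewrite ?andbF // (size_words wn).
Qed.

End Chains.

Local Open Scope nat_scope.

(** * Chain counts depend only on the end letters *)

Definition permute (Is w : seq nat) : seq nat := [seq nth 0 w i | i <- Is].

Lemma permute_inj Is u v : perm_eq Is (iota 0 (size u)) -> size v = size u ->
  permute Is u = permute Is v -> u = v.
Proof.
move=> perm_Is eq_size /eq_in_map eq_uv; apply: (@eq_from_nth _ 0) => // i lt_iu.
by apply: eq_uv; rewrite (perm_mem perm_Is) mem_iota.
Qed.

Lemma perm_permute Is w : perm_eq Is (iota 0 (size w)) -> perm_eq (permute Is w) w.
Proof. by move=> perm_Is; rewrite -[X in perm_eq _ X](mkseq_nth 0) perm_map. Qed.

Lemma st_permute Is w : perm_eq Is (iota 0 (size w)) -> st (permute Is w) = permute Is (st w).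
Proof.
move=> perm_Is; have rank_eq x : rank (permute Is w) x = rank w x.
  by rewrite /rank (seq.permP (perm_permute perm_Is)).
rewrite stE -map_comp; apply/eq_in_map => i; rewrite (perm_mem perm_Is) mem_iota => lt_iw.
by rewrite /= nth_st // rank_eq.
Qed.

Lemma perm_rcons_iota Is l : perm_eq (rcons Is l) (iota 0 l.+1) = perm_eq Is (iota 0 l).
Proof. by rewrite -addn1 iotaD -cats1 perm_cat2r. Qed.

Section PermuteBlocks.

(* [Is] permutes the positions of the first [l] letters of a pattern of length
   [l.+1], fixing the first one, which is shared with the previous block. *)
Variables (l : nat) (Is : seq nat).
Hypotheses (l_gt0 : 0 < l) (perm_Is : perm_eq Is (iota 0 l)) (head_Is : nth 0 Is 0 = 0).

Fixpoint permute_blocks k w : seq nat :=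
  if k is k'.+1 then permute Is (take l w) ++ permute_blocks k' (drop l w) else w.

Let size_Is : size Is = l. Proof. by rewrite (perm_size perm_Is) size_iota. Qed.

Let perm_Is_take w : l <= size w -> perm_eq Is (iota 0 (size (take l w))).
Proof. by move=> le_lw; rewrite size_takel. Qed.

Lemma perm_permute_blocks k w : k * l <= size w -> perm_eq (permute_blocks k w) w.
Proof.
elim: k w => //= k IH w; rewrite mulSn => le_kw.
rewrite -[X in perm_eq _ X](cat_take_drop l w) perm_cat ?IH ?size_drop //; last by lia.
by rewrite perm_permute // perm_Is_take; lia.
Qed.

Lemma permute_blocks_inj k u v : k * l <= size u -> size v = size u ->
  permute_blocks k u = permute_blocks k v -> u = v.
Proof.
elim: k u v => //= k IH u v; rewrite mulSn => le_ku eq_size /eqP.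
rewrite eqseq_cat ?size_map // => /andP[/eqP eq_take /eqP eq_drop].
rewrite -(cat_take_drop l u) -(cat_take_drop l v); congr (_ ++ _).
  apply: permute_inj eq_take; last by rewrite !size_take eq_size.
  by rewrite perm_Is_take; lia.
by apply: IH eq_drop; rewrite !size_drop; lia.
Qed.

Lemma take1_permute_blocks k w : k * l <= size w -> take 1 (permute_blocks k w) = take 1 w.
Proof.
case: k => // k; rewrite mulSn => le_kw /=.
have -> : Is = 0 :: behead Is.
  by rewrite -[X in X :: _]head_Is -drop1 -drop_nth ?drop0 // size_Is.
case: w le_kw => [|x w] /= le_kw; first by lia.
by rewrite nth_take // !take0.
Qed.

Lemma chain_permute_blocks k p w : size p = l.+1 -> size w = (k * l).+1 ->
  chain (permute (rcons Is l) p) k (permute_blocks k w) = chain p k w.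
Proof.
move=> size_p; have perm_Isl : perm_eq (rcons Is l) (iota 0 l.+1) by rewrite perm_rcons_iota.
elim: k w => [|k IH] w size_w; first by rewrite /= size_w.
have le_lw : l <= size w by rewrite size_w; lia.
have take_w : take l.+1 (permute_blocks k.+1 w) = permute (rcons Is l) (take l.+1 w).
  rewrite /permute map_rcons /= take_cat size_map size_Is ltnNge leqnSn /= subSnn.
  rewrite take1_permute_blocks ?size_drop ?size_w; last by lia.
  rewrite (drop_nth 0) ?size_w /=; last by lia.
  rewrite take0 cats1 nth_take //; congr rcons; apply/eq_in_map => i.
  rewrite (perm_mem perm_Is) mem_iota => /andP[_ lt_il].
  by rewrite !nth_take // ltnW.
have size_take_w : size (take l.+1 w) = l.+1 by rewrite size_takel // size_w; lia.
rewrite /= size_map size_rcons size_Is size_p /=; congr (_ && _).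
  rewrite /occ size_map size_rcons size_Is size_p take_w st_permute ?size_take_w //.
  by apply/eqP/eqP => [/permute_inj-> | ->//]; rewrite ?size_st ?size_take_w.
by rewrite drop_size_cat ?size_map // IH // size_drop size_w; lia.
Qed.

Lemma chain_count_permute p k : size p = l.+1 ->
  chain_count (permute (rcons Is l) p) k = chain_count p k.
Proof.
move=> size_p; rewrite /chain_count size_map size_rcons size_Is size_p /=.
set n := (k * l).+1; have le_kl w : w \in words n -> k * l <= size w.
  by move/size_words->; apply: leqnSn.
have perm_blocks : perm_eq [seq permute_blocks k w | w <- words n] (words n).
  apply: perm_map_words => [u v un vn | w wn].
    by apply: permute_blocks_inj; rewrite ?le_kl // (size_words un) (size_words vn).
  by rewrite mem_permutations (perm_trans (perm_permute_blocks (le_kl w wn))) // perm_words.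
rewrite -(seq.permP perm_blocks) count_map; apply: eq_in_count => w wn /=.
by rewrite chain_permute_blocks // (size_words wn).
Qed.

End PermuteBlocks.

Lemma chain_count_ends n p q k : p \in words n -> q \in words n -> 1 < n ->
  head 0 p = head 0 q -> last 0 p = last 0 q -> chain_count p k = chain_count q k.
Proof.
case: n => [|[|l]] // pn qn _; have size_p := size_words pn; have size_q := size_words qn.
rewrite -!nth0 -!nth_last size_p size_q /= => eq_head eq_last.
have [Js perm_Js def_q] : exists2 Js, perm_eq Js (iota 0 l.+2) & q = permute Js p.
  by rewrite -size_p; apply/perm_iotaP; rewrite (perm_trans (perm_words qn)) // perm_sym perm_words.
have size_Js : size Js = l.+2 by rewrite (perm_size perm_Js) size_iota.
have fixed i : i < l.+2 -> nth 0 p i = nth 0 q i -> nth 0 Js i = i.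
  move=> lt_i; rewrite def_q (nth_map 0) ?size_Js // => /eqP.
  have lt_Ji : nth 0 Js i < l.+2.
    by have := mem_nth 0 (_ : i < size Js); rewrite size_Js (perm_mem perm_Js) mem_iota; apply.
  by rewrite nth_uniq ?size_p ?(uniq_words pn) // => /eqP.
have def_Js : Js = rcons (take l.+1 Js) l.+1.
  rewrite -[X in rcons _ X](fixed l.+1) // -take_nth ?size_Js //.
  by rewrite take_oversize ?size_Js.
rewrite def_q def_Js chain_count_permute //; last by rewrite nth_take // fixed.
by rewrite -perm_rcons_iota -def_Js.
Qed.

(** * Pairs of occurrences sharing one letter *)

Lemma bin_gt1 n k : 0 < k < n -> 1 < 'C(n, k).
Proof.
case: n k => [|n] [|k] // lt_kn.
by rewrite binS; have := bin_gt0 n k; have := bin_gt0 n k.+1; lia.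
Qed.

Lemma card_sets_through (T : finType) (x : T) (L R : {set T}) i j :
  x \notin L -> R = ~: (x |: L) ->
  #|[set A : {set T} | [&& x \in A, #|A :&: L| == i & #|A :&: R| == j]]| =
  'C(#|L|, i) * 'C(#|R|, j).
Proof.
move=> xL def_R; rewrite -(cards_draws L i) -(cards_draws R j) -cardsX.
have in_R y : (y \in R) = (y != x) && (y \notin L) by rewrite def_R !inE negb_or.
pose parts (A : {set T}) := (A :&: L, A :&: R).
have joinK (A : {set T}) : x \in A -> x |: (A :&: L :|: A :&: R) = A.
  move=> xA; apply/setP => y; rewrite !inE in_R.
  by case: eqP => [->|_]; rewrite ?xA // -andb_orr orbN andbT.
have disjLR : [disjoint L & R] by rewrite def_R -subsets_disjoint subsetUr.
have setI_x (B : {set T}) : x \notin B -> [set x] :&: B = set0.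
  by move=> xB; apply/eqP; rewrite setI_eq0 disjoints1.
have xR : x \notin R by rewrite in_R eqxx.
have partsK (B C : {set T}) : B \subset L -> C \subset R -> parts (x |: (B :|: C)) = (B, C).
  move=> BL CR; rewrite /parts !setIUl !setI_x // !set0U (setIidPl BL) (setIidPl CR).
  have /disjoint_setI0-> : [disjoint B & R] := disjointWl BL disjLR.
  have /disjoint_setI0 : [disjoint L & C] := disjointWr CR disjLR.
  by rewrite setIC => ->; rewrite setU0 set0U.
rewrite -(@card_in_imset _ _ parts) => [|A A']; last first.
  by rewrite !inE => /andP[xA _] /andP[xA' _] [eqL eqR]; rewrite -(joinK A) // eqL eqR joinK.
apply: eq_card => -[B C]; rewrite !inE /=; apply/imsetP/andP => [[A]|].
  by rewrite inE => /and3P[_ AL AR] [-> ->]; rewrite !subsetIr.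
case=> /andP[BL cardB] /andP[CR cardC]; exists (x |: (B :|: C)); last by rewrite partsK.
by have [eqL eqR] := partsK B C BL CR; rewrite inE eqL eqR cardB cardC setU11.
Qed.

Lemma card_sets_rank n (x : 'I_n) k i : i < k ->
  #|[set A : {set 'I_n} | [&& #|A| == k, x \in A & #|A :&: [set y : 'I_n | y < x]| == i]]| =
  'C(x, i) * 'C(n - x.+1, k - i.+1).
Proof.
move=> lt_ik; set L := [set y : 'I_n | y < x]; pose R := ~: (x |: L).
have xL : x \notin L by rewrite inE ltnn.
have card_L : #|L| = x.
  by rewrite cardsE -sum1_card -(big_ord_widen n (fun=> 1)) ?sum1_card ?card_ord // ltnW.
have card_R : #|R| = n - x.+1 by rewrite cardsCs setCK cardsU1 xL card_L card_ord.
have cards (A : {set 'I_n}) : x \in A -> #|A| = (#|A :&: L| + #|A :&: R|).+1.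
  move=> xA; rewrite -(cardsID (x |: L) A) setDE setIUr (setIidPr _) ?sub1set //.
  by rewrite cardsU1 in_setI (negbTE xL) andbF.
rewrite -card_R -[X in 'C(X, i)]card_L -(card_sets_through _ _ xL (erefl R)).
apply: eq_card => A; rewrite !inE; case: (boolP (x \in A)) => [/cards->|_]; last by rewrite andbF.
by rewrite /= andbC; case: (_ =P i) => //= ->; move: #|_| => r; lia.
Qed.

Section ChainPairs.

Variables (l : nat) (p : seq nat).
Hypothesis p_words : p \in words l.+1.

Let a := head 0 p.
Let b := last 0 p.
Let n := (2 * l).+1.

Let head_bound : 0 < a <= l.+1. Proof. by rewrite /a -nth0 nth_words. Qed.
Let last_bound : 0 < b <= l.+1. Proof. by rewrite /b -nth_last (size_words p_words) nth_words. Qed.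

Lemma chain_pair w : w \in words n ->
  chain p 2 w = [&& st (take l.+1 w) == p, st (drop l.+1 w) == st (behead p)
                  & nth 0 w l == (a + b).-1].
Proof.
move=> wn; have size_w := size_words wn; have size_p := size_words p_words.
set x := nth 0 w l; set u := take l.+1 w; set v := drop l.+1 w.
have def_p : p = a :: behead p by case: p size_p @a.
have drop_w : drop l w = x :: v by rewrite (drop_nth 0) // size_w; lia.
have uniq_w := uniq_words wn; have uniq_p := uniq_words p_words.
have x_notin : x \notin v by have := drop_uniq l uniq_w; rewrite drop_w => /andP[].
have a_notin : a \notin behead p by move: uniq_p; rewrite {1}def_p => /andP[].
have x_bound : 0 < x <= n by rewrite nth_words //; lia.
rewrite /= /occ size_p /= !size_drop size_w [take _ (drop _ _)]take_oversize; last first.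
  by rewrite size_drop size_w; lia.
have -> : n - l - l == 1 by lia.
rewrite andbT; case: (st u =P p) => //= st_u.
rewrite drop_w -[X in st (x :: v) == X](st_words p_words) def_p st_cons_eq //= [RHS]andbC.
congr (_ && _).
have rank_a : rank (behead p) a = a.-1.
  by rewrite -(rank_words p_words head_bound) [in RHS]def_p /rank /= ltnn.
have size_u : size u = l.+1 by rewrite size_takel // size_w /n; lia.
have rank_u : rank u x = b.-1.
  by rewrite /b -st_u -nth_last size_st nth_st size_u //= nth_take.
rewrite rank_a; have := rank_words wn x_bound.
by rewrite /rank -[w](cat_take_drop l.+1) count_cat -/u -/v -!/(rank _ _) rank_u; lia.
Qed.

(* The shared letter is the [b]-th smallest one of the first occurrence, so its
   value can be read off the set of letters of this occurrence. *)
Lemma chain_pair_value_set w (A := value_set n (take l.+1 w)) (x := inord (a + b).-2) :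
  w \in words n -> st (take l.+1 w) = p ->
  (nth 0 w l == (a + b).-1) =
  (x \in A) && (#|A :&: [set y : 'I_n | y < x]| == b.-1).
Proof.
move=> wn st_u; have size_w := size_words wn; set u := take l.+1 w in A st_u *.
have size_u : size u = l.+1 by rewrite size_takel // size_w /n; lia.
have last_u : last 0 u = nth 0 w l by rewrite -nth_last size_u nth_take.
have val_x : x.+1 = (a + b).-1 by rewrite inordK; lia.
have -> : (x \in A) = ((a + b).-1 \in u) by rewrite inE val_x.
have -> : #|A :&: [set y : 'I_n | y < x]| = rank u (a + b).-1.
  rewrite /rank -(@card_value_set n) ?take_uniq ?(uniq_words wn) //.
    by apply: eq_card => y; rewrite !inE -val_x ltnS.
  by move=> z /mem_take; rewrite (mem_words wn).
have last_in_u : last 0 u \in u by rewrite -nth_last mem_nth ?size_u.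
have rank_last : rank u (last 0 u) = b.-1.
  by rewrite /b -st_u -[in RHS]nth_last size_st nth_st ?size_u //= -nth_last size_u.
rewrite -last_u -rank_last; apply/eqP/andP => [<-|[in_u /eqP eq_rank]]; first by [].
exact: (@rank_inj u).
Qed.

Lemma chain_count_pair :
  chain_count p 2 = 'C((a + b).-2, b.-1) * 'C(l.+1.*2 - (a + b), l.+1 - b).
Proof.
pose x : 'I_n := inord (a + b).-2; have size_p := size_words p_words.
have val_x : x = (a + b).-2 :> nat by rewrite inordK; lia.
have st_p : st (behead p) \in words (n - l.+1).
  have -> : n - l.+1 = size (behead p) by rewrite size_behead size_p /n; lia.
  by rewrite st_in_words // -drop1 drop_uniq // (uniq_words p_words).
have sum_words_eq k u : u \in words k -> \sum_(v <- words k) (v == u) = 1.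
  by move=> uk; rewrite -big_mkcond sum1_count count_uniq_mem ?permutations_uniq // uk.
pose has_rank (A : {set 'I_n}) := (x \in A) && (#|A :&: [set y : 'I_n | y < x]| == b.-1).
transitivity (\sum_(w <- words n) has_rank (value_set n (take l.+1 w)) *
    ((st (take l.+1 w) == p) * (st (drop l.+1 w) == st (behead p)))).
  rewrite /chain_count size_p -[(_ * _).+1]/n -sum1_count big_mkcond.
  apply: eq_big_seq => w wn; rewrite chain_pair //.
  case: (st _ =P p) => [st_u|_] /=; last by rewrite muln0.
  by rewrite andbC chain_pair_value_set // mul1n mulnb; case: (_ && _).
rewrite (big_words_cut _ (fun A u v => has_rank A * ((u == p) * (v == st (behead p))))); last first.
  by rewrite /n; lia.
transitivity (\sum_(A : {set 'I_n} | #|A| == l.+1) has_rank A).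
  apply: eq_bigr => A _; under eq_bigr do rewrite -big_distrr.
  by rewrite -big_distrr -big_distrlr /= !sum_words_eq ?muln1.
rewrite -big_mkcondr sum1dep_card card_sets_rank; last by lia.
by rewrite val_x; congr (_ * binomial _ _); lia.
Qed.

End ChainPairs.

(** * Overlap-free words with prescribed ends *)

Definition free_word n a b : seq nat := rem b (iota a (n - a)) ++ iota 1 a.-1 ++ [:: n; b].

Section FreeWord.

Variables n a b : nat.
Hypotheses (a_gt0 : 0 < a) (lt_ab : a < b) (lt_bn : b < n).

Let b_in : b \in iota a (n - a). Proof. by rewrite mem_iota; lia. Qed.
Let run := rem b (iota a (n - a)).
Let size_run : size run = (n - a).-1. Proof. by rewrite size_rem ?size_iota. Qed.

Lemma free_word_words : free_word n a b \in words n.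
Proof.
have def_iota : iota 1 n = iota 1 a.-1 ++ iota a (n - a) ++ [:: n].
  have {1}-> : n = a.-1 + (n - a + 1) by lia.
  by rewrite !iotaD add1n prednK //= subnKC //; lia.
rewrite mem_permutations def_iota; apply/seq.permP => P.
by rewrite !count_cat (seq.permP (perm_to_rem b_in)) /=; lia.
Qed.

Lemma head_free_word : head 0 (free_word n a b) = a.
Proof.
rewrite /free_word; have -> : n - a = (n - a).-1.+1 by lia.
by rewrite /= (ltn_eqF lt_ab).
Qed.

Lemma last_free_word : last 0 (free_word n a b) = b.
Proof. by rewrite /free_word !last_cat. Qed.

Lemma nth_free_word_run i : i < (n - a).-1 -> nth 0 (free_word n a b) i = nth 0 run i.
Proof. by move=> lt_i; rewrite nth_cat size_run lt_i. Qed.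

Lemma nth_free_word_low i : i < a.-1 -> nth 0 (free_word n a b) ((n - a).-1 + i) = i.+1.
Proof.
move=> lt_i; rewrite nth_cat size_run ltnNge leq_addr addKn /= nth_cat size_iota lt_i.
by rewrite nth_iota.
Qed.

Lemma nth_free_word_max : nth 0 (free_word n a b) n.-2 = n.
Proof.
have -> : n.-2 = (n - a).-1 + (a.-1 + 0) by lia.
by rewrite nth_cat size_run ltnNge leq_addr addKn /= nth_cat size_iota ltnNge leq_addr addKn.
Qed.

Lemma free_word_run_mono i : i.+1 < (n - a).-1 ->
  nth 0 (free_word n a b) i < nth 0 (free_word n a b) i.+1.
Proof.
move=> lt_i; rewrite !nth_free_word_run ?(ltnW lt_i) //.
have run_sorted : sorted ltn run.
  by apply: subseq_sorted (rem_subseq _ _) (iota_ltn_sorted _ _); apply: ltn_trans.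
by move/(sortedP 0): run_sorted; apply; rewrite size_run.
Qed.

Lemma free_word_descent i : i.+2 < n ->
  nth 0 (free_word n a b) i.+1 < nth 0 (free_word n a b) i -> i.+1 = (n - a).-1 /\ 1 < a.
Proof.
move=> lt_in desc; have le_wn : nth 0 (free_word n a b) i <= n.
  by have /andP[] := nth_words free_word_words (ltnW (ltnW lt_in)).
case: (ltngtP i.+1 (n - a).-1) => [lt_i|lt_i|eq_i].
- by have := free_word_run_mono lt_i; lia.
- have [def_i|neq_i] := eqVneq i.+1 n.-2; first by move: desc; rewrite def_i nth_free_word_max; lia.
  have [j def_j] : exists j, i = (n - a).-1 + j by exists (i - (n - a).-1); lia.
  by move: desc; rewrite def_j -addnS !nth_free_word_low; lia.
split=> //; rewrite ltnNge; apply/negP => le_a1.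
have def_i : i.+1 = n.-2 by lia.
by move: desc; rewrite def_i nth_free_word_max; lia.
Qed.

(* An overlap matches the final descent [n, b] with the only other descent,
   whose second letter 1 is the smallest one of the prefix, whereas [b] is
   larger than the letter [a.-1] before [n]. *)
Lemma overlap_free_free_word : a = 1 \/ a + 2 < n -> overlap_free (free_word n a b).
Proof.
move=> a_n; have size_w := size_words free_word_words.
apply/allP => d; rewrite mem_iota size_w => d_n; apply/eqP => eq_st.
set w := free_word n a b in size_w eq_st *.
have [t def_n] : exists t, n = d + t.+2 by exists (n - d - 2); lia.
have iso i j : i < t.+2 -> j < t.+2 ->
    (nth 0 w (d + i) < nth 0 w (d + j)) = (nth 0 w i < nth 0 w j).
  have def_t : n - d = t.+2 by lia.
  move=> lt_i lt_j; rewrite -!nth_drop -ltn_nth_st ?size_drop ?size_w ?def_t // eq_st def_t.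
  by rewrite ltn_nth_st ?nth_take // size_takel // size_w; lia.
have last_w : nth 0 w (d + t.+1) = b.
  by rewrite -last_free_word -nth_last size_w; congr nth; lia.
have max_w : nth 0 w (d + t) = n by rewrite -[RHS]nth_free_word_max; congr nth; lia.
have [def_t a_gt1] : t.+1 = (n - a).-1 /\ 1 < a.
  by apply: free_word_descent; [lia | rewrite -iso ?last_w ?max_w].
have low_w : nth 0 w t.+1 = 1 by rewrite def_t -[X in nth 0 w X]addn0 nth_free_word_low //; lia.
have before_max : nth 0 w (d + t.-1) = a.-1.
  have -> : d + t.-1 = (n - a).-1 + a.-2 by lia.
  by rewrite nth_free_word_low; lia.
have := iso t.-1 t.+1; rewrite last_w before_max low_w => iso_low.
have := nth_words free_word_words (_ : t.-1 < n); rewrite -/w; lia.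
Qed.

End FreeWord.

(** * Strong c-Wilf equivalence and the end letters *)

Lemma pfirstE m (pi : 'S_m) : pfirst pi = head 0 (pword pi).
Proof. exact: nth0. Qed.

Lemma plastE m (pi : 'S_m) : plast pi = last 0 (pword pi).
Proof. by rewrite -nth_last (size_pword pi). Qed.

Lemma standard_form_bounds m (pi : 'S_m) : standard_form pi ->
  0 < pfirst pi /\ pfirst pi < plast pi <= m.
Proof.
case: m pi => [|m] pi [lt_ab _].
  by move: lt_ab; rewrite pfirstE plastE (size0nil (size_pword pi)).
have /andP[-> _] := nth_words (pword_words pi) (ltn0Sn m).
by have /andP[_ ->] := nth_words (pword_words pi) (ltnSn m); rewrite lt_ab.
Qed.

Lemma pword_neq0 m (pi : 'S_m) : 0 < m -> pword pi != [::].
Proof. by rewrite -size_eq0 (size_pword pi) lt0n. Qed.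

Lemma strong_cwilf_em_sum m (pi tau : 'S_m) :
  strong_cwilf_equiv pi tau -> em_sum (pword pi) =1 em_sum (pword tau).
Proof.
move=> strong n; have perm_em : perm_eq [seq em (pword pi) w | w <- words n]
                                        [seq em (pword tau) w | w <- words n].
  by apply/allP => k _ /=; rewrite !count_map -!acount_words strong.
have em_sumE s : em_sum s n = (\sum_(k <- [seq em s w | w <- words n]) (1 + 'X) ^+ k)%R.
  by rewrite big_map.
by rewrite !em_sumE (perm_big _ perm_em).
Qed.

Lemma strong_cwilf_chain_count m (pi tau : 'S_m) k : 1 < m -> 0 < k ->
  strong_cwilf_equiv pi tau -> chain_count (pword pi) k = chain_count (pword tau) k.
Proof.
move=> m_gt1 k_gt0 /strong_cwilf_em_sum.
move/(em_sum_cluster_sum (pword_neq0 pi (ltnW m_gt1)) (pword_neq0 tau (ltnW m_gt1))).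
move/(_ (k * m.-1).+1)/(congr1 (fun P : {poly int} => P`_k)%R).
have coef_chain (s : 'S_m) :
    ((cluster_sum (pword s) (k * m.-1).+1)`_k = (chain_count (pword s) k)%:R)%R.
  by have := @coef_cluster_sum_chain_count (pword s) _ k k_gt0; rewrite size_pword; apply.
by rewrite !coef_chain => /eqP; rewrite Num.Theory.eqr_nat => /eqP.
Qed.

Lemma chain_count_cwilf m (pi tau : 'S_m) : 1 < m ->
  overlap_free (pword pi) -> overlap_free (pword tau) ->
  (forall k, 0 < k -> chain_count (pword pi) k = chain_count (pword tau) k) ->
  cwilf_equiv pi tau.
Proof.
move=> m_gt1 pi_free tau_free eq_chain n.
have eq_cluster : cluster_sum (pword pi) =1 cluster_sum (pword tau).
  move=> l; apply/polyP => k; rewrite !coef_cluster_sum_overlap_free ?size_pword //.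
  by case: (posnP k) => //= k_gt0; rewrite eq_chain.
have m_gt0 := ltnW m_gt1.
have eq_em := (em_sum_cluster_sum (pword_neq0 pi m_gt0) (pword_neq0 tau m_gt0)).2 eq_cluster.
by apply/eqP; rewrite !acount_words -(Num.Theory.eqr_nat int) -!hornerN1_em_sum eq_em.
Qed.

Lemma overlap_free_non_overlapping m (pi : 'S_m) : 1 < m ->
  overlap_free (pword pi) -> non_overlapping pi.
Proof.
case: m pi => [|[|m]] // pi _ /allP pi_free; have size_pi := size_pword pi.
have iota_last : iota 1 m.+1 = iota 1 m ++ [:: m.+1] by rewrite -(addn1 m) iotaD addn1.
rewrite /non_overlapping /overlap_set [_.-1]/= iota_last filter_cat /=.
have st_size1 u : size u = 1 -> st u = [:: 1] by case: u => [|x []] //= _; rewrite /st /= ltnn.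
rewrite !st_size1 ?size_drop ?size_takel ?size_pi ?subSnn // eqxx.
rewrite (_ : filter _ _ = [::]) //; apply/eqP; rewrite -(negbK (_ == _)) -has_filter.
by apply/hasPn => d d_m; have := pi_free d; rewrite size_pi; apply.
Qed.

Lemma exists_overlap_free m (pi : 'S_m) :
  standard_form pi -> plast pi != m -> m != 4 ->
  exists rho : 'S_m, [/\ overlap_free (pword rho), pfirst rho = pfirst pi,
    plast rho = plast pi & forall k, chain_count (pword rho) k = chain_count (pword pi) k].
Proof.
move=> sf_pi neq_bm m_neq4; have [a_gt0 /andP[lt_ab le_bm]] := standard_form_bounds sf_pi.
have lt_bm : plast pi < m by rewrite ltn_neqAle neq_bm.
have [_ le_ab] := sf_pi; have word_free := free_word_words a_gt0 lt_ab lt_bm.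
have head_free := head_free_word a_gt0 lt_ab lt_bm.
have last_free := last_free_word m (pfirst pi) (plast pi).
have [rho def_rho] := pword_onto word_free; exists rho; rewrite pfirstE plastE def_rho.
split=> // [|k]; first by apply: overlap_free_free_word => //; lia.
apply: (chain_count_ends _ word_free (pword_words pi)); first by lia.
  by rewrite head_free pfirstE.
by rewrite last_free plastE.
Qed.

Lemma chain_count_pair_ends m (pi : 'S_m) : 0 < m ->
  chain_count (pword pi) 2 =
  'C((pfirst pi + plast pi).-2, (plast pi).-1) * 'C(m.*2 - (pfirst pi + plast pi), m - plast pi).
Proof.
by case: m pi => // m pi _; rewrite (chain_count_pair (pword_words pi)) -pfirstE -plastE.
Qed.

Lemma chain_count_pair_last_max m (pi tau : 'S_m) : standard_form pi -> standard_form tau ->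
  chain_count (pword pi) 2 = chain_count (pword tau) 2 -> plast pi = m ->
  pfirst pi = pfirst tau /\ plast pi = plast tau.
Proof.
move=> sf_pi sf_tau; have [a_gt0 lt_ab] := standard_form_bounds sf_pi; have [_ le_ab] := sf_pi.
have [c_gt0 lt_cd] := standard_form_bounds sf_tau.
rewrite !chain_count_pair_ends; try lia; move=> + last_pi.
have first_pi : pfirst pi = 1 by lia.
rewrite first_pi last_pi subnn bin0 add1n binn => eq1.
have := @bin_gt1 (pfirst tau + plast tau).-2 (plast tau).-1.
have := @bin_gt1 (m.*2 - (pfirst tau + plast tau)) (m - plast tau).
move/esym/eqP: eq1; rewrite muln1 muln_eq1 => /andP[/eqP-> /eqP->]; lia.
Qed.

Lemma chain_count_pair_order4 m (pi tau : 'S_m) : m = 4 ->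
  standard_form pi -> standard_form tau ->
  chain_count (pword pi) 2 = chain_count (pword tau) 2 ->
  pfirst pi = pfirst tau /\ plast pi = plast tau.
Proof.
move=> m4; have ends (s : 'S_m) : standard_form s ->
    (pfirst s, plast s) \in [:: (1, 2); (1, 3); (1, 4); (2, 3)].
  move=> sf_s; have [] := standard_form_bounds sf_s; have [] := sf_s.
  by rewrite !inE !xpair_eqE; lia.
move=> /ends ends_pi /ends ends_tau; rewrite !chain_count_pair_ends; try by rewrite m4.
by move: ends_pi ends_tau; rewrite !inE => /or4P[]/eqP[-> ->] /or4P[]/eqP[-> ->]; rewrite m4.
Qed.

Theorem theorem1p8 :
  (forall (m : nat) (pi tau : 'S_m), 1 <= m ->
      non_overlapping pi -> non_overlapping tau ->
      standard_form pi -> standard_form tau ->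
      cwilf_equiv pi tau ->
      pfirst pi = pfirst tau /\ plast pi = plast tau) ->
  (forall (m : nat) (pi tau : 'S_m), 1 <= m ->
      standard_form pi -> standard_form tau ->
      strong_cwilf_equiv pi tau ->
      pfirst pi = pfirst tau /\ plast pi = plast tau).
Proof.
move=> non_overlapping_ends m pi tau _ sf_pi sf_tau strong.
have m_gt1 : 1 < m by have := standard_form_bounds sf_pi; lia.
have eq_chain k : 0 < k -> chain_count (pword pi) k = chain_count (pword tau) k.
  by move=> k_gt0; apply: strong_cwilf_chain_count.
have eq_pair := eq_chain 2 isT.
have [/chain_count_pair_order4 m4|m_neq4] := eqVneq m 4; first exact: m4.
have [/(chain_count_pair_last_max sf_pi sf_tau eq_pair) //|neq_pi] := eqVneq (plast pi) m.
have [/(chain_count_pair_last_max sf_tau sf_pi (esym eq_pair))[-> ->] //|neq_tau] :=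
  eqVneq (plast tau) m.
have [rho [rho_free first_rho last_rho rho_chain]] := exists_overlap_free sf_pi neq_pi m_neq4.
have [sig [sig_free first_sig last_sig sig_chain]] := exists_overlap_free sf_tau neq_tau m_neq4.
rewrite -first_rho -first_sig -last_rho -last_sig.
apply: non_overlapping_ends; rewrite ?(ltnW m_gt1) //.
- exact: overlap_free_non_overlapping.
- exact: overlap_free_non_overlapping.
- by rewrite /standard_form first_rho last_rho.
- by rewrite /standard_form first_sig last_sig.
by apply: chain_count_cwilf => // k k_gt0; rewrite rho_chain sig_chain eq_chain.
Qed.
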